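(* Choose \(\lambda\in\mathbb R\setminus\mathbb Q\), \(\xi\in\mathbb R\setminus\mathbb Z\), and \(L\in\mathbb N\) with \(L\|\xi\|_{\mathbb T}>1+|\lambda|\). Define \(g_1(t)=t^{3/2}\) and \(g_2(t)=\lambda t^{3/2}+L(t+\xi)\). Then: (i) For every \(F\in\nabla_{\mathbb Z}\text{-}\mathrm{span}(g_1,g_2)\), \(\lim_{t\to\infty}|F(t)|\in\{0,\infty\}\). (ii) There exists a set \(E\subset\mathbb N\) of positive natural density such that \(R_{g_1}(E)\cap R_{g_2}(E)=\varnothing\).
   Context: \(\mathbb N=\{1,2,\ldots\}\). For \(x\in\mathbb R\), \(\|x\|_{\mathbb T}=\min_{m\in\mathbb Z}|x-m|\). For functions \(f_1,\ldots,f_k\), \(\nabla_{\mathbb Z}\text{-}\mathrm{span}(f_1,\ldots,f_k)=\{\sum_{i=1}^k\sum_{m=0}^{M}c_{i,m}f_i^{(m)}: M\ge 0,\ c_{i,m}\in\mathbb Z\}\), where \(f^{(m)}\) is the \(m\)-th derivative. For \(E\subset\mathbb N\) and \(r\in\mathbb Z\), \(E-r=\{m\in\mathbb N: m+r\in E\}\); for real-valued \(f\), \(R_f(E)=\{n\in\mathbb N: E\cap(E-\lfloor f(n)\rfloor)\neq\varnothing\}\). Natural density: \(d(E)=\lim_{N\to\infty}|E\cap\{1,\ldots,N\}|/N\) when it exists. *)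

(* Defs.v *)
From Stdlib Require Import Reals Lra Lia ZArith List ClassicalEpsilon.
From Stdlib Require Import Zfloor.
From Coquelicot Require Import Coquelicot.
Open Scope R_scope.

(* The paper's N = {1, 2, ...} is encoded as the n : nat with (1 <= n)%nat. *)

Definition irrational (x : R) : Prop :=
  ~ exists p q : Z, q <> 0%Z /\ x = IZR p / IZR q.

Definition non_integer (x : R) : Prop := ~ exists m : Z, x = IZR m.

(* The infimum is a minimum: see torus_norm_min. *)
Definition torus_norm (x : R) : R :=
  real (Glb_Rbar (fun y => exists m : Z, y = Rabs (x - IZR m))).

Lemma torus_norm_min (x : R) :
  (exists m : Z, torus_norm x = Rabs (x - IZR m)) /\
  (forall m : Z, torus_norm x <= Rabs (x - IZR m)).
Proof.
assert (H : exists m0 : Z, forall m : Z, Rabs (x - IZR m0) <= Rabs (x - IZR m)).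
{ destruct (Zfloor_bound x) as [H1 H2]; set (k := Zfloor x) in *.
  assert (Hm : forall m : Z, IZR m <= IZR k \/ IZR k + 1 <= IZR m).
  { intros m; destruct (Z_le_gt_dec m k) as [h|h].
    - left; now apply IZR_le.
    - right; rewrite <- plus_IZR; apply IZR_le; lia. }
  destruct (Rle_dec (x - IZR k) (1/2)) as [h|h].
  - exists k; intros m; destruct (Hm m); unfold Rabs;
      destruct (Rcase_abs (x - IZR k)), (Rcase_abs (x - IZR m)); lra.
  - exists (k + 1)%Z; intros m; rewrite plus_IZR; destruct (Hm m); unfold Rabs;
      destruct (Rcase_abs (x - (IZR k + 1))), (Rcase_abs (x - IZR m)); lra. }
destruct H as [m0 H].
assert (E : torus_norm x = Rabs (x - IZR m0)).
{ unfold torus_norm.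
  rewrite (is_glb_Rbar_unique _ (Finite (Rabs (x - IZR m0)))); [reflexivity|].
  split.
  - intros y [m ->]; apply H.
  - intros b Hb; apply Hb; now exists m0. }
split; [now exists m0 | intros m; rewrite E; apply H].
Qed.

(* Functions are considered on (0, +oo), so membership in the span constrains F there only. *)
Definition nablaZ_span (fs : list (R -> R)) (F : R -> R) : Prop :=
  exists (M : nat) (c : nat -> nat -> Z), forall t : R, 0 < t ->
    F t = fold_right Rplus 0
            (map (fun i => sum_n (fun m =>
                    IZR (c i m) * Derive_n (nth i fs (fun _ => 0)) m t) M)
                 (seq 0 (length fs))).

Definition shift (E : nat -> Prop) (r : Z) (m : nat) : Prop :=
  (1 <= m)%nat /\ exists k : nat, Z.of_nat k = (Z.of_nat m + r)%Z /\ E k.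

Definition return_set (f : R -> R) (E : nat -> Prop) (n : nat) : Prop :=
  (1 <= n)%nat /\ exists m : nat, E m /\ shift E (Zfloor (f (INR n))) m.

Definition count (E : nat -> Prop) (N : nat) : nat :=
  length (filter (fun n => if excluded_middle_informative (E n) then true else false)
                 (seq 1 N)).

Definition has_natural_density (E : nat -> Prop) (d : R) : Prop :=
  is_lim_seq (fun N => INR (count E N) / INR N) d.

Definition g1 (t : R) : R := Rpower t (3 / 2).

Definition g2 (lambda xi : R) (L : nat) (t : R) : R :=
  lambda * Rpower t (3 / 2) + INR L * (t + xi).

(* Main.v *)
Require Import Defs.
From Stdlib Require Import Reals List Lra Lia ZArith Zfloor ClassicalEpsilon.
From Coquelicot Require Import Coquelicot.
Import ListNotations.
Open Scope R_scope.

(** For (i), the coefficient of [t^(3/2-m)] in an element of the span is a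
    nonzero multiple of [c_{1,m} + lambda c_{2,m}], which vanishes only if both
    integers do; so the polynomial contributions of [g2] can survive only when
    dominated by a power [t^(3/2)] or [t^(1/2)].

    For (ii), [floor (g2 n) - lambda floor (g1 n)] is within [1 + |lambda|] of
    [L (n + xi)], so [floor (g2 n) / L - lambda floor (g1 n) / L] stays away from
    the integers.  Hence it cannot happen that [floor (g1 n)] and [floor (g2 n)]
    are both differences of elements of [{L k : {k mu} < theta}] with
    [mu = lambda] or [mu = - lambda] and [theta] small.  Choosing [theta] of the
    form [{q mu}] makes the density elementary, since
    [1_{{x} < {y}} = floor x - floor (x - y) - floor y] telescopes along
    [x = k mu], [y = q mu]. *)

Definition frac (x : R) : R := x - IZR (Zfloor x).

Lemma frac_bound (x : R) : 0 <= frac x < 1.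
Proof. unfold frac; destruct (Zfloor_bound x); lra. Qed.

(** * Irrational rotations *)

(** Otherwise [x = - p / q]. Besides the rotation argument, this lets one vanishing coefficient in
    (i) kill two integers at once. *)
Lemma irrational_combination (x : R) (p q : Z) :
  irrational x -> IZR p + x * IZR q = 0 -> p = 0%Z /\ q = 0%Z.
Proof.
intros Hx E; destruct (Z.eq_dec q 0) as [->|Hq].
- split; [|reflexivity]; apply eq_IZR; lra.
- exfalso; apply Hx; exists (- p)%Z, q; split; [exact Hq|].
  apply not_0_IZR in Hq; rewrite opp_IZR.
  apply (Rmult_eq_reg_r (IZR q)); [|exact Hq].
  unfold Rdiv; rewrite Rmult_assoc, Rinv_l by exact Hq; lra.
Qed.

(* If [t] is a value and [m = floor (1/t)], then [1 - m t] and [(m+1) t - 1] are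
   values too and sum to [t], so one of them is at most [t/2]. *)
Lemma small_integer_combination (x : R) (n : nat) : irrational x ->
  exists q p : Z, q <> 0%Z /\ 0 < IZR q * x - IZR p <= (/ 2) ^ n.
Proof.
intros Hx.
assert (Hne : forall q p : Z, q <> 0%Z -> IZR q * x - IZR p <> 0).
{ intros q p Hq E; apply Hq.
  apply (irrational_combination x (- p) q Hx); rewrite opp_IZR; lra. }
induction n as [|n IH].
- exists 1%Z, (Zfloor x); split; [lia|].
  generalize (Hne 1%Z (Zfloor x) ltac:(lia)); destruct (Zfloor_bound x).
  simpl; lra.
- destruct IH as [q [p [Hq Ht]]]; set (t := IZR q * x - IZR p) in *.
  destruct (Zfloor_bound (/ t)) as [Hm1 Hm2]; set (m := Zfloor (/ t)) in *.
  assert (Ht1 : t <= 1).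
  { apply (Rle_trans _ _ _ (proj2 Ht)); rewrite pow_inv.
    rewrite <- Rinv_1; apply Rinv_le_contravar; [lra|].
    apply pow_R1_Rle; lra. }
  assert (Hm : (1 <= m)%Z).
  { apply Zfloor_lub; rewrite <- Rinv_1 at 1; apply Rinv_le_contravar; lra. }
  assert (Et : / t * t = 1) by (apply Rinv_l; lra).
  assert (H1 : IZR m * t <= 1)
    by (rewrite <- Et; apply Rmult_le_compat_r; lra).
  assert (H2 : 1 < (IZR m + 1) * t)
    by (rewrite <- Et at 1; apply Rmult_lt_compat_r; lra).
  simpl; destruct (Rle_dec (1 - IZR m * t) (t / 2)) as [h|h].
  + assert (Hq' : (- m * q)%Z <> 0%Z) by nia.
    (* The floor gives only [0 <= 1 - m t]; irrationality makes it strict. *)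
    generalize (Hne _ (- m * p - 1)%Z Hq'); intros Hnz.
    exists (- m * q)%Z, (- m * p - 1)%Z; split; [exact Hq'|].
    revert Hnz; rewrite minus_IZR, !mult_IZR, opp_IZR.
    replace (- IZR m * IZR q * x - (- IZR m * IZR p - 1)) with (1 - IZR m * t)
      by (unfold t; ring).
    lra.
  + exists ((m + 1) * q)%Z, ((m + 1) * p + 1)%Z; split; [nia|].
    rewrite plus_IZR, !mult_IZR, plus_IZR.
    replace ((IZR m + 1) * IZR q * x - ((IZR m + 1) * IZR p + 1))
      with ((IZR m + 1) * t - 1) by (unfold t; ring).
    lra.
Qed.

(** The multiplier [q] must be natural, as it becomes the length of a telescoping sum; a negative
    one is absorbed by replacing [x] with [- x]. *)
Lemma small_fractional_multiple (x eps : R) : irrational x -> 0 < eps ->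
  exists mu : R, (mu = x \/ mu = - x) /\
    exists q : nat, 0 < frac (INR q * mu) < eps.
Proof.
intros Hx He.
(* Staying below 1 as well as below [eps] makes [p] the floor of [q x]. *)
destruct (pow_lt_1_zero (/ 2) ltac:(rewrite Rabs_pos_eq; lra) (Rmin eps 1)
            ltac:(apply Rmin_pos; lra)) as [n Hn].
specialize (Hn n (le_n n)); rewrite Rabs_pos_eq in Hn by (apply pow_le; lra).
destruct (small_integer_combination x n Hx) as [q [p [Hq Hqp]]].
generalize (Rmin_l eps 1) (Rmin_r eps 1); intros Hl Hr.
assert (Hf : frac (IZR q * x) = IZR q * x - IZR p).
{ unfold frac; rewrite (Zfloor_eq p); lra. }
destruct (Z_le_gt_dec 0 q) as [h|h].
- exists x; split; [now left|]; exists (Z.to_nat q).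
  rewrite INR_IZR_INZ, Z2Nat.id by lia; rewrite Hf; lra.
- exists (- x); split; [now right|]; exists (Z.to_nat (- q)).
  rewrite INR_IZR_INZ, Z2Nat.id by lia; rewrite opp_IZR.
  replace (- IZR q * - x) with (IZR q * x) by ring; rewrite Hf; lra.
Qed.

(** * Density of dilated rotation sets *)

Definition indic (P : Prop) : R := if excluded_middle_informative P then 1 else 0.

Lemma count_succ (E : nat -> Prop) (N : nat) :
  INR (count E (S N)) = INR (count E N) + indic (E (S N)).
Proof.
unfold count, indic; rewrite seq_S, filter_app, length_app, plus_INR.
simpl; destruct (excluded_middle_informative _); simpl; lra.
Qed.

(** Subtracting [y] from [x] borrows 1 from the integer parts exactly when [frac x < frac y]. *)
Lemma indic_frac_lt (x y : R) :
  indic (frac x < frac y) =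
  IZR (Zfloor x) - IZR (Zfloor (x - y)) - IZR (Zfloor y).
Proof.
generalize (frac_bound x) (frac_bound y); intros Hx Hy.
unfold indic; destruct (excluded_middle_informative _) as [h|h]; unfold frac in *.
- rewrite (Zfloor_eq (Zfloor x - Zfloor y - 1) (x - y)); rewrite ?minus_IZR; lra.
- rewrite (Zfloor_eq (Zfloor x - Zfloor y) (x - y)); rewrite ?minus_IZR; lra.
Qed.

(* Closed form of the telescoping sum
   [sum_(1 <= k <= K) (floor (k mu) - floor ((k - q) mu))]. *)
Fixpoint floor_sum (mu : R) (q : nat) (K : R) : R :=
  match q with
  | O => 0
  | S j => floor_sum mu j K +
      (IZR (Zfloor ((K - INR j) * mu)) - IZR (Zfloor (- INR j * mu)))
  end.

(** The floor at index [j] for [K + 1] is the one at index [j - 1] for [K], so all but the two end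
    floors cancel. *)
Lemma floor_sum_succ (mu : R) (q : nat) (K : R) :
  floor_sum mu q (K + 1) =
  floor_sum mu q K +
  (IZR (Zfloor ((K + 1) * mu)) - IZR (Zfloor ((K + 1 - INR q) * mu))).
Proof.
induction q as [|q IH].
- simpl; rewrite Rminus_0_r; lra.
- simpl floor_sum; rewrite IH, S_INR.
  replace (K + 1 - (INR q + 1)) with (K - INR q) by ring; lra.
Qed.

Lemma floor_sum_0 (mu : R) (q : nat) : floor_sum mu q 0 = 0.
Proof.
induction q as [|q IH]; simpl; [reflexivity|].
rewrite IH, Rminus_0_l; lra.
Qed.

(** Each of the [q] summands is a difference of floors of two reals that differ by [K mu], hence
    within 1 of [K mu]. *)
Lemma floor_sum_approx (mu : R) (q : nat) (K : R) :
  Rabs (floor_sum mu q K - K * (INR q * mu)) <= INR q.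
Proof.
induction q as [|q IH].
- simpl; rewrite Rmult_0_l, Rmult_0_r, Rminus_0_r, Rabs_R0; lra.
- simpl floor_sum; rewrite S_INR.
  generalize (Zfloor_bound ((K - INR q) * mu)) (Zfloor_bound (- INR q * mu)).
  intros H1 H2; apply Rabs_le_between in IH; apply Rabs_le_between.
  replace ((K - INR q) * mu) with (K * mu + - INR q * mu) in * by ring.
  split; lra.
Qed.

(** The threshold is a multiple of [mu] modulo 1, so the indicators telescope and the error is
    bounded uniformly in [K]: a bounded remainder set. *)
Lemma count_rotation (mu : R) (q K : nat) :
  Rabs (INR (count (fun k => frac (INR k * mu) < frac (INR q * mu)) K)
        - INR K * frac (INR q * mu)) <= INR q.
Proof.
assert (E : INR (count (fun k => frac (INR k * mu) < frac (INR q * mu)) K)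
  = floor_sum mu q (INR K) - INR K * IZR (Zfloor (INR q * mu))).
{ induction K as [|K IH].
  - unfold count; simpl; rewrite floor_sum_0; lra.
  - rewrite count_succ, IH, indic_frac_lt, S_INR, floor_sum_succ.
    replace ((INR K + 1) * mu - INR q * mu) with ((INR K + 1 - INR q) * mu) by ring.
    lra. }
rewrite E; unfold frac at 1.
replace (_ - _) with (floor_sum mu q (INR K) - INR K * (INR q * mu)) by ring.
apply floor_sum_approx.
Qed.

Definition dilate (L : nat) (B : nat -> Prop) (n : nat) : Prop :=
  exists k : nat, (1 <= k)%nat /\ n = (L * k)%nat /\ B k.

(** From [N] to [S N] either count can change only if [L] divides [S N], that is, if
    [N mod L = L - 1]. *)
Lemma count_dilate (L : nat) (B : nat -> Prop) (N : nat) : (1 <= L)%nat ->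
  count (dilate L B) N = count B (N / L).
Proof.
intros HL; apply INR_eq.
induction N as [|N IH].
- rewrite Nat.Div0.div_0_l; reflexivity.
- rewrite count_succ, IH.
  generalize (Nat.div_mod_eq N L) (Nat.mod_upper_bound N L ltac:(lia)).
  set (K := (N / L)%nat); intros HN Hr.
  destruct (Nat.eq_dec (S (N mod L)) L) as [h|h].
  + assert (EN : S N = (L * S K)%nat) by (rewrite Nat.mul_succ_r; lia).
    replace (S N / L)%nat with (S K)
      by (apply Nat.div_unique with 0%nat; [lia|rewrite EN; ring]).
    rewrite count_succ; f_equal; unfold indic.
    destruct (excluded_middle_informative _) as [h1|h1],
      (excluded_middle_informative _) as [h2|h2]; try reflexivity; exfalso.
    * destruct h1 as [k [_ [Ek Bk]]]; apply h2.
      replace (S K) with k by nia; exact Bk.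
    * apply h1; exists (S K); repeat split; [lia|exact EN|exact h2].
  + replace (S N / L)%nat with K
      by (apply Nat.div_unique with (S (N mod L)); lia).
    unfold indic; destruct (excluded_middle_informative _) as [h1|h1]; [|lra].
    exfalso; destruct h1 as [k [_ [Ek _]]].
    assert (K < k)%nat by nia; assert (k < S K)%nat by nia; lia.
Qed.

Lemma density_of_bounded_error (E : nat -> Prop) (d C : R) :
  (forall N, Rabs (INR (count E N) - d * INR N) <= C) ->
  has_natural_density E d.
Proof.
intros H; unfold has_natural_density.
assert (H0 : is_lim_seq (fun N => C * / INR N) 0).
{ replace (Finite 0) with (Rbar_mult C 0) by (simpl; f_equal; ring).
  apply is_lim_seq_scal_l.
  replace (Finite 0) with (Rbar_inv p_infty) by reflexivity.
  apply is_lim_seq_inv; [apply is_lim_seq_INR|easy]. }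
apply is_lim_seq_le_le_loc with (u := fun N => d - C * / INR N)
  (w := fun N => d + C * / INR N).
- exists 1%nat; intros N HN.
  assert (HN' : 0 < INR N) by (apply lt_0_INR; lia).
  assert (Hi : 0 < / INR N) by now apply Rinv_0_lt_compat.
  specialize (H N); apply Rabs_le_between in H.
  assert (Ed : d = d * INR N * / INR N) by (field; lra).
  assert (H1 := Rmult_le_compat_r _ _ _ (Rlt_le _ _ Hi) (proj1 H)).
  assert (H2 := Rmult_le_compat_r _ _ _ (Rlt_le _ _ Hi) (proj2 H)).
  unfold Rdiv; split; lra.
- replace (Finite d) with (Finite (d - 0)) by (f_equal; ring).
  apply is_lim_seq_minus'; [apply is_lim_seq_const|exact H0].
- replace (Finite d) with (Finite (d + 0)) by (f_equal; ring).
  apply is_lim_seq_plus'; [apply is_lim_seq_const|exact H0].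
Qed.

Lemma density_dilated_rotation (mu : R) (q L : nat) : (1 <= L)%nat ->
  has_natural_density
    (dilate L (fun k => frac (INR k * mu) < frac (INR q * mu)))
    (frac (INR q * mu) / INR L).
Proof.
intros HL; apply density_of_bounded_error with (INR q + 1); intros N.
rewrite count_dilate by exact HL.
generalize (count_rotation mu q (N / L)).
set (c := INR (count _ _)); generalize (frac_bound (INR q * mu)).
set (th := frac _); intros Hth Hc.
assert (HL' : 1 <= INR L) by (apply (le_INR 1); exact HL).
generalize (Nat.div_mod_eq N L) (Nat.mod_upper_bound N L ltac:(lia)).
set (K := (N / L)%nat) in *; intros HN Hr.
apply lt_INR in Hr; generalize (pos_INR (N mod L)); intros Hr0.
apply (f_equal INR) in HN; rewrite plus_INR, mult_INR in HN.
(* [s] is the incomplete last block as a share of [L]; it costs at most [th <= 1], whence the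
   constant [q + 1]. *)
set (s := INR (N mod L) / INR L).
assert (Hs : 0 <= s <= 1).
{ unfold s; split.
  - apply Rdiv_le_0_compat; lra.
  - apply Rle_div_l; lra. }
replace (th / INR L * INR N) with (INR K * th + th * s)
  by (rewrite HN; unfold s; field; lra).
apply Rabs_le_between in Hc; apply Rabs_le_between; nra.
Qed.

(** * Incompatibility of the two return sets *)

(** A common return would put [L xi] at distance less than [L theta + 1 + |lambda|] from a multiple
    of [L]; the bound on [theta] makes this at most [L] times the torus norm of [xi], a
    contradiction. *)
Lemma no_common_return (lambda xi mu theta : R) (L n : nat) (B : nat -> Prop) :
  (1 <= L)%nat -> (mu = lambda \/ mu = - lambda) ->
  (forall k, B k -> frac (INR k * mu) < theta) ->
  INR L * theta <= INR L * torus_norm xi - (1 + Rabs lambda) ->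
  ~ (return_set g1 (dilate L B) n /\ return_set (g2 lambda xi L) (dilate L B) n).
Proof.
intros HL Hmu HB Hth [[_ [m1 [E1 [_ [m1' [S1 E1']]]]]] [_ [m2 [E2 [_ [m2' [S2 E2']]]]]]].
destruct E1 as [k1 [_ [-> B1]]], E1' as [k1' [_ [-> B1']]].
destruct E2 as [k2 [_ [-> _]]], E2' as [k2' [_ [-> _]]].
apply HB in B1, B1'.
generalize (Zfloor_bound (g1 (INR n))) (Zfloor_bound (g2 lambda xi L (INR n))).
set (a := Zfloor (g1 _)) in *; set (b := Zfloor (g2 _ _ _ _)) in *.
unfold g2; fold (g1 (INR n)); set (x := g1 (INR n)).
intros Ha Hb.
assert (HL' : 1 <= INR L) by (apply (le_INR 1); exact HL).
assert (Ea : IZR a = INR L * (INR k1' - INR k1)).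
{ rewrite !INR_IZR_INZ, <- minus_IZR, <- mult_IZR; f_equal; lia. }
assert (Eb : IZR b = INR L * (INR k2' - INR k2)).
{ rewrite !INR_IZR_INZ, <- minus_IZR, <- mult_IZR; f_equal; lia. }
assert (Hw : exists (w : Z) (eta : R),
  lambda * (INR k1' - INR k1) = IZR w + eta /\ Rabs eta < theta).
{ generalize (frac_bound (INR k1 * mu)) (frac_bound (INR k1' * mu)).
  intros F1 F1'.
  set (w := (Zfloor (INR k1' * mu) - Zfloor (INR k1 * mu))%Z).
  set (eta := frac (INR k1' * mu) - frac (INR k1 * mu)).
  assert (Heta : Rabs eta < theta) by (apply Rabs_lt_between; unfold eta; lra).
  assert (Hsum : mu * (INR k1' - INR k1) = IZR w + eta)
    by (unfold w, eta, frac; rewrite minus_IZR; ring).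
  destruct Hmu as [-> | ->].
  - exists w, eta; easy.
  - exists (- w)%Z, (- eta); rewrite Rabs_Ropp, opp_IZR; split; [lra|easy]. }
destruct Hw as [w [eta [Ew Heta]]].
(* [j] is the integer close to [xi]: insert [a = L (k1' - k1)] and [b = L (k2' - k2)] in
   [b ~ lambda a + L (n + xi)], divide by [L] and drop [eta]. *)
set (j := (Z.of_nat k2' - Z.of_nat k2 - Z.of_nat n - w)%Z).
generalize (proj2 (torus_norm_min xi) j); intros Hj.
assert (Ej : IZR j = INR k2' - INR k2 - INR n - IZR w)
  by (unfold j; rewrite !minus_IZR, <- !INR_IZR_INZ; reflexivity).
set (beta := lambda * x + INR L * (INR n + xi) - IZR b) in *.
assert (Hlt : INR L * Rabs (xi - IZR j) < INR L * theta + (1 + Rabs lambda)).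
{ rewrite <- (Rabs_pos_eq (INR L)) at 1 by lra; rewrite <- Rabs_mult.
  (* Three errors: the rounding of [g2], [lambda] times the rounding of [g1], and [L eta]. *)
  replace (INR L * (xi - IZR j))
    with (beta + (- (lambda * (x - IZR a)) - INR L * eta))
    by (unfold beta; rewrite Ej, Ea, Eb; replace (IZR w)
          with (lambda * (INR k1' - INR k1) - eta) by lra; ring).
  assert (H1 : Rabs beta <= 1) by (apply Rabs_le_between; unfold beta; lra).
  assert (H2 : Rabs (- (lambda * (x - IZR a))) <= Rabs lambda).
  { rewrite Rabs_Ropp, Rabs_mult, (Rabs_pos_eq (x - IZR a)) by lra.
    generalize (Rabs_pos lambda); nra. }
  assert (H3 : Rabs (- (INR L * eta)) < INR L * theta).
  { rewrite Rabs_Ropp, Rabs_mult, (Rabs_pos_eq (INR L)) by lra; nra. }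
  apply Rle_lt_trans with (1 := Rabs_triang _ _).
  assert (H4 : Rabs (- (lambda * (x - IZR a)) - INR L * eta)
    <= Rabs (- (lambda * (x - IZR a))) + Rabs (- (INR L * eta)))
    by apply Rabs_triang.
  lra. }
assert (INR L * torus_norm xi <= INR L * Rabs (xi - IZR j))
  by (apply Rmult_le_compat_l; lra).
lra.
Qed.

(** * Growth of the differential span *)

Lemma is_lim_Rpower_p (a : R) : 0 < a ->
  is_lim (fun t => Rpower t a) p_infty p_infty.
Proof.
intros Ha; unfold Rpower.
apply is_lim_comp with p_infty; [apply is_lim_exp_p| |now exists 0].
replace p_infty with (Rbar_mult a p_infty) at 2.
- apply is_lim_scal_l, is_lim_ln_p.
- apply is_Rbar_mult_unique, is_Rbar_mult_sym, is_Rbar_mult_p_infty_pos; exact Ha.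
Qed.

Lemma is_lim_Rpower_neg (a : R) : a < 0 ->
  is_lim (fun t => Rpower t a) p_infty 0.
Proof.
intros Ha; unfold Rpower.
apply is_lim_comp with m_infty; [apply is_lim_exp_m| |now exists 0].
replace m_infty with (Rbar_mult a p_infty).
- apply is_lim_scal_l, is_lim_ln_p.
- apply is_Rbar_mult_unique, is_Rbar_mult_sym, is_Rbar_mult_p_infty_neg; exact Ha.
Qed.

Lemma is_lim_plus_0 (f g : R -> R) (l : R) :
  is_lim f p_infty l -> is_lim g p_infty 0 ->
  is_lim (fun t => f t + g t) p_infty l.
Proof.
intros Hf Hg; replace (Finite l) with (Finite (l + 0)) by (f_equal; ring).
now apply is_lim_plus'.
Qed.

Lemma is_lim_mult_0 (f g : R -> R) (l : R) :
  is_lim f p_infty l -> is_lim g p_infty 0 ->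
  is_lim (fun t => f t * g t) p_infty 0.
Proof.
intros Hf Hg; replace (Finite 0) with (Rbar_mult l 0) by (simpl; f_equal; ring).
now apply is_lim_mult.
Qed.

Lemma is_lim_abs_dominant (F h : R -> R) (a A : R) :
  0 < a -> A <> 0 -> is_lim h p_infty A ->
  (forall t, 0 < t -> F t = Rpower t a * h t) ->
  is_lim (fun t => Rabs (F t)) p_infty p_infty.
Proof.
intros Ha HA Hh HF.
apply is_lim_ext_loc with (fun t => Rpower t a * Rabs (h t)).
{ exists 0; intros t Ht; rewrite HF by exact Ht.
  rewrite Rabs_mult, (Rabs_pos_eq (Rpower t a)); [reflexivity|].
  left; apply exp_pos. }
assert (HA' : 0 < Rabs A) by now apply Rabs_pos_lt.
replace p_infty with (Rbar_mult p_infty (Rabs A)) at 2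
  by now apply is_Rbar_mult_unique, is_Rbar_mult_p_infty_pos.
apply is_lim_mult.
- now apply is_lim_Rpower_p.
- now apply (is_lim_Rabs h p_infty A).
- simpl; apply not_eq_sym, Rlt_not_eq; exact HA'.
Qed.

(** Falling factorial [a (a-1) ... (a-m+1)], the coefficient in the [m]-th derivative of [t^a]. *)
Fixpoint falling (a : R) (m : nat) : R :=
  match m with O => 1 | S k => falling a k * (a - INR k) end.

Lemma Derive_n_Rpower_affine (a l b x : R) (m : nat) (t : R) : 0 < t ->
  Derive_n (fun s => l * Rpower s a + b * (s + x)) m t =
  l * (falling a m * Rpower t (a - INR m)) +
  b * match m with O => t + x | 1%nat => 1 | _ => 0 end.
Proof.
revert t; induction m as [|m IH]; intros t Ht.
- simpl; rewrite Rminus_0_r; ring.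
- simpl Derive_n.
  rewrite (Derive_ext_loc _ (fun s => l * (falling a m * Rpower s (a - INR m)) +
    b * match m with O => s + x | 1%nat => 1 | _ => 0 end)).
  (* The induction hypothesis covers positive arguments only; the ball of radius [t] about [t] stays
     among them. *)
  2:{ exists (mkposreal t Ht); intros s Hs; apply IH.
      apply Rabs_lt_between in Hs; simpl in Hs; unfold minus, plus, opp in Hs; simpl in Hs.
      lra. }
  apply is_derive_unique.
  apply (is_derive_plus (V := R_NormedModule)).
  + simpl falling; rewrite S_INR.
    replace (a - (INR m + 1)) with (a - INR m - 1) by ring.
    replace (l * _) with (l * (falling a m *
      ((a - INR m) * Rpower t (a - INR m - 1)))) by ring.
    apply is_derive_scal, is_derive_scal, is_derive_Reals.
    now apply derivable_pt_lim_power.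
  + apply is_derive_scal; destruct m as [|[|m]]; auto_derive; easy.
Qed.

Lemma Derive_n_g1 (m : nat) (t : R) : 0 < t ->
  Derive_n g1 m t = falling (3 / 2) m * Rpower t (3 / 2 - INR m).
Proof.
intros Ht.
rewrite (Derive_n_ext g1 (fun s => 1 * Rpower s (3 / 2) + 0 * (s + 0)))
  by (intros s; unfold g1; ring).
rewrite Derive_n_Rpower_affine by exact Ht; ring.
Qed.

(** Only orders 0 and 1 matter at infinity: from order 2 on the affine part of [g2] is gone and the
    exponent [3/2 - m] is negative, so these terms go into [r]. *)
Lemma span_expansion (lambda xi : R) (L : nat) (F : R -> R) :
  nablaZ_span [g1; g2 lambda xi L] F ->
  exists (p0 p1 q0 q1 : Z) (r : R -> R), is_lim r p_infty 0 /\
    forall t, 0 < t ->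
      F t = (IZR p0 + lambda * IZR q0) * Rpower t (3 / 2)
            + (IZR p1 + lambda * IZR q1) * (3 / 2) * Rpower t (1 / 2)
            + IZR q0 * INR L * (t + xi) + IZR q1 * INR L + r t.
Proof.
intros [M [c HF]].
enough (exists (p0 p1 q0 q1 : Z) (r : R -> R), is_lim r p_infty 0 /\
    forall t, 0 < t ->
      sum_n (fun m => IZR (c 0%nat m) * Derive_n g1 m t) M +
      sum_n (fun m => IZR (c 1%nat m) * Derive_n (g2 lambda xi L) m t) M =
            (IZR p0 + lambda * IZR q0) * Rpower t (3 / 2)
            + (IZR p1 + lambda * IZR q1) * (3 / 2) * Rpower t (1 / 2)
            + IZR q0 * INR L * (t + xi) + IZR q1 * INR L + r t)
  as [p0 [p1 [q0 [q1 [r [Hr H]]]]]].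
{ exists p0, p1, q0, q1, r; split; [exact Hr|]; intros t Ht.
  rewrite <- H, HF by exact Ht; simpl; ring. }
clear HF F.
assert (D1 : forall m t, 0 < t -> IZR (c 0%nat m) * Derive_n g1 m t +
   IZR (c 1%nat m) * Derive_n (g2 lambda xi L) m t =
   (IZR (c 0%nat m) + lambda * IZR (c 1%nat m)) *
     (falling (3 / 2) m * Rpower t (3 / 2 - INR m)) +
   IZR (c 1%nat m) * INR L * match m with O => t + xi | 1%nat => 1 | _ => 0 end).
{ intros m t Ht; rewrite Derive_n_g1 by exact Ht; unfold g2.
  rewrite Derive_n_Rpower_affine by exact Ht; ring. }
assert (step : forall M t, sum_n (fun m => IZR (c 0%nat m) * Derive_n g1 m t) (S M) +
   sum_n (fun m => IZR (c 1%nat m) * Derive_n (g2 lambda xi L) m t) (S M) =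
   (sum_n (fun m => IZR (c 0%nat m) * Derive_n g1 m t) M +
   sum_n (fun m => IZR (c 1%nat m) * Derive_n (g2 lambda xi L) m t) M) +
   (IZR (c 0%nat (S M)) * Derive_n g1 (S M) t +
   IZR (c 1%nat (S M)) * Derive_n (g2 lambda xi L) (S M) t)).
{ intros N t; rewrite !sum_Sn; unfold plus; simpl; ring. }
assert (base : forall t, 0 < t ->
   sum_n (fun m => IZR (c 0%nat m) * Derive_n g1 m t) 0 +
   sum_n (fun m => IZR (c 1%nat m) * Derive_n (g2 lambda xi L) m t) 0 =
   (IZR (c 0%nat 0%nat) + lambda * IZR (c 1%nat 0%nat)) * Rpower t (3 / 2) +
   IZR (c 1%nat 0%nat) * INR L * (t + xi)).
{ intros t Ht; rewrite !sum_O, D1 by exact Ht; simpl; rewrite Rminus_0_r; ring. }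
destruct M as [|M].
- exists (c 0%nat 0%nat), 0%Z, (c 1%nat 0%nat), 0%Z, (fun _ => 0).
  split; [apply is_lim_const|]; intros t Ht; rewrite base by exact Ht; ring.
- exists (c 0%nat 0%nat), (c 0%nat 1%nat), (c 1%nat 0%nat), (c 1%nat 1%nat).
  (* The four integers are fixed before the induction; only [r] changes with [M]. *)
  induction M as [|M [r [Hr H]]].
  + exists (fun _ => 0); split; [apply is_lim_const|]; intros t Ht.
    rewrite step, base, D1 by exact Ht; simpl.
    replace (3 / 2 - 1) with (1 / 2) by field; field.
  + exists (fun t => r t + (IZR (c 0%nat (S (S M))) + lambda * IZR (c 1%nat (S (S M)))) *
      falling (3 / 2) (S (S M)) * Rpower t (3 / 2 - INR (S (S M)))).
    split.
    * apply is_lim_plus_0; [exact Hr|].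
      eapply is_lim_mult_0; [apply is_lim_const|].
      apply is_lim_Rpower_neg; rewrite !S_INR; generalize (pos_INR M); lra.
    * intros t Ht; rewrite step, H, D1 by exact Ht; ring.
Qed.

Lemma span_limit (lambda xi : R) (L : nat) (F : R -> R) :
  irrational lambda -> nablaZ_span [g1; g2 lambda xi L] F ->
  is_lim (fun t => Rabs (F t)) p_infty 0 \/
  is_lim (fun t => Rabs (F t)) p_infty p_infty.
Proof.
intros Hl HF; apply span_expansion in HF.
destruct HF as [p0 [p1 [q0 [q1 [r [Hr HF]]]]]].
set (A := IZR p0 + lambda * IZR q0) in *.
set (B := IZR p1 + lambda * IZR q1) in *.
assert (P : forall t a b, Rpower t a * Rpower t b = Rpower t (a + b))
  by (intros; symmetry; apply Rpower_plus).
destruct (Req_dec A 0) as [HA|HA]; [destruct (Req_dec B 0) as [HB|HB]|].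
(* [A = B = 0] forces [q0 = q1 = 0], so the linear and constant terms vanish with the powers,
   leaving [r]. *)
- left.
  apply (irrational_combination _ _ _ Hl) in HA; destruct HA as [-> ->].
  apply (irrational_combination _ _ _ Hl) in HB; destruct HB as [-> ->].
  rewrite <- Rabs_R0; apply (is_lim_Rabs F p_infty 0).
  apply is_lim_ext_loc with r; [|exact Hr].
  exists 0; intros t Ht; rewrite HF by exact Ht; unfold A, B; ring.
- right.
  apply (irrational_combination _ _ _ Hl) in HA; destruct HA as [-> ->].
  apply is_lim_abs_dominant with (a := 1 / 2) (A := B * (3 / 2))
    (h := fun t => B * (3 / 2) + (IZR q1 * INR L + r t) * Rpower t (- (1 / 2)));
    [lra|lra| |].
  + apply is_lim_plus_0; [apply is_lim_const|].
    eapply is_lim_mult_0; [|apply is_lim_Rpower_neg; lra].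
    apply is_lim_plus_0; [apply is_lim_const|exact Hr].
  + intros t Ht; rewrite HF by exact Ht; unfold A.
    assert (E : Rpower t (1 / 2) * Rpower t (- (1 / 2)) = 1)
      by (rewrite P, Rplus_opp_r; apply Rpower_O, Ht).
    transitivity (B * (3 / 2) * Rpower t (1 / 2) + (IZR q1 * INR L + r t)
      * (Rpower t (1 / 2) * Rpower t (- (1 / 2)))); [rewrite E|]; ring.
(* Divided by [t^(3/2)], the linear term decays like [t^(-1/2)], so the limit is [A]. *)
- right; clearbody A B.
  apply is_lim_abs_dominant with (a := 3 / 2) (A := A)
    (h := fun t => A + B * (3 / 2) * Rpower t (- 1)
                   + IZR q0 * INR L * Rpower t (- (1 / 2))
                   + (IZR q0 * INR L * xi + IZR q1 * INR L + r t)
                     * Rpower t (- (3 / 2))); [lra|exact HA| |].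
  + repeat apply is_lim_plus_0; try apply is_lim_const;
      (eapply is_lim_mult_0; [|apply is_lim_Rpower_neg; lra]);
      try apply is_lim_const.
    apply is_lim_plus_0; [apply is_lim_const|exact Hr].
  + intros t Ht; rewrite HF by exact Ht.
    assert (E1 : Rpower t (3 / 2) * Rpower t (- 1) = Rpower t (1 / 2))
      by (rewrite P; f_equal; field).
    assert (E2 : Rpower t (3 / 2) * Rpower t (- (1 / 2)) = t)
      by (transitivity (Rpower t 1); [rewrite P; f_equal; field|now apply Rpower_1]).
    assert (E3 : Rpower t (3 / 2) * Rpower t (- (3 / 2)) = 1)
      by (rewrite P, Rplus_opp_r; apply Rpower_O, Ht).
    transitivity (A * Rpower t (3 / 2)
      + B * (3 / 2) * (Rpower t (3 / 2) * Rpower t (- 1))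
      + IZR q0 * INR L * (Rpower t (3 / 2) * Rpower t (- (1 / 2)))
      + (IZR q0 * INR L * xi + IZR q1 * INR L + r t)
        * (Rpower t (3 / 2) * Rpower t (- (3 / 2)))); [rewrite E1, E2, E3|]; ring.
Qed.

Theorem theorem1p6 (lambda xi : R) (L : nat)
    (hlambda : irrational lambda) (hxi : non_integer xi) (hL : (1 <= L)%nat)
    (hLxi : INR L * torus_norm xi > 1 + Rabs lambda) :
  (forall F : R -> R, nablaZ_span [g1; g2 lambda xi L] F ->
     is_lim (fun t => Rabs (F t)) p_infty 0 \/
     is_lim (fun t => Rabs (F t)) p_infty p_infty) /\
  (exists E : nat -> Prop,
     (forall n, E n -> (1 <= n)%nat) /\
     (exists d : R, 0 < d /\ has_natural_density E d) /\
     (forall n, ~ (return_set g1 E n /\ return_set (g2 lambda xi L) E n))).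
Proof.
split; [intros F; now apply span_limit|].
assert (HL' : 1 <= INR L) by (apply (le_INR 1); exact hL).
(* The slack in [hLxi] divided by [L]: the largest [theta] that [no_common_return] allows. *)
set (delta := (INR L * torus_norm xi - (1 + Rabs lambda)) / INR L).
assert (Hd : 0 < delta) by (apply Rdiv_lt_0_compat; lra).
destruct (small_fractional_multiple lambda delta hlambda Hd)
  as [mu [Hmu [q Hq]]].
(* The threshold lies strictly between 0 and [delta]: its positivity gives positive density, its
   smallness excludes common returns. *)
exists (dilate L (fun k => frac (INR k * mu) < frac (INR q * mu))).
split; [|split].
- intros n [k [Hk [-> _]]]; nia.
- exists (frac (INR q * mu) / INR L); split.
  + apply Rdiv_lt_0_compat; lra.
  + now apply density_dilated_rotation.
- intros n; apply no_common_return with mu (frac (INR q * mu)); trivial.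
  replace (_ - _) with (INR L * delta) by (unfold delta; field; lra).
  apply Rmult_le_compat_l; lra.
Qed.
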